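(* Let $a,b$ be positive integers with $\gcd(a,b)=1$, let $d$ be a non-negative integer, and let $(x_0,y_0)\in\mathbb Z^2$ be a solution of $ax_0+by_0=d$. Then $d\in\mathcal C_{a,b}$ if and only if there exists an integer $k$ in the closed interval $[-y_0/a,\,x_0/b]$ (or in the closed interval $[x_0/b,\,-y_0/a]$ if $-y_0/a>x_0/b$).
   Context: For positive integers $a,b$, define $\mathcal C_{a,b}=\{d\in\mathbb Z_{\geq 0} : d=ax+by \text{ for some } x,y\in\mathbb Z_{\geq 0}\}$. *)

(* Defs.v *)
From mathcomp Require Import all_boot all_order all_algebra.

Set Implicit Arguments.
Unset Strict Implicit.
Unset Printing Implicit Defensive.

Definition C (a b : nat) (d : nat) : Prop :=
  exists x y : nat, d = (a * x + b * y)%N.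

(* Main.v *)
Require Import Defs.
From mathcomp Require Import all_boot all_order all_algebra.
From mathcomp Require Import ring zify.

Set Implicit Arguments.
Unset Strict Implicit.
Unset Printing Implicit Defensive.

Import Order.TTheory GRing.Theory Num.Theory.
Local Open Scope ring_scope.

(** The integer solutions of [a x + b y = d] are the pairs
    [(x0 - b k, y0 + a k)], which are nonnegative exactly when
    [- y0 / a <= k <= x0 / b]. Since [x0 / b + y0 / a = d / (a b) >= 0], the
    endpoints always come in that order. *)

(** Multiplying by the positive denominators turns the two rational bounds into [- y0 <= k * a] and
    [k * b <= x0] over the integers. *)
Lemma itv_solutionE (a b : nat) (x0 y0 k : int) : (0 < a)%N -> (0 < b)%N ->
  (k%:Q \in `[- y0%:Q / a%:Q, x0%:Q / b%:Q]) =
  (0 <= y0 + a%:Z * k) && (0 <= x0 - b%:Z * k).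
Proof.
move=> a0 b0; rewrite in_itv /= ler_pdivrMr ?ler_pdivlMr ?ltr0z //.
by rewrite -mulrNz -!intrM !ler_int; congr (_ && _); lia.
Qed.

Lemma endpoints_le (a b d : nat) (x0 y0 : int) : (0 < a)%N -> (0 < b)%N ->
  a%:Z * x0 + b%:Z * y0 = d%:Z -> - y0%:Q / a%:Q <= x0%:Q / b%:Q.
Proof.
move=> a0 b0 hd; rewrite ler_pdivrMr ?ltr0z // mulrAC ler_pdivlMr ?ltr0z //.
by rewrite -mulrNz -!intrM ler_int; lia.
Qed.

(** Subtracting the two equations gives [eq_diff]; by Gauss's lemma [b] then divides [x0 - x], and
    the quotient is [k]. *)
Lemma coprime_solutions (a b : nat) (x y x0 y0 : int) : (0 < b)%N ->
  coprime a b -> a%:Z * x + b%:Z * y = a%:Z * x0 + b%:Z * y0 ->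
  exists k : int, x = x0 - b%:Z * k /\ y = y0 + a%:Z * k.
Proof.
move=> b0 cab eq_sol.
have eq_diff : a%:Z * (x0 - x) = b%:Z * (y - y0) by lia.
have : (b%:Z %| x0 - x)%Z.
  rewrite -(@Gauss_dvdzr b%:Z a%:Z); first by rewrite eq_diff dvdz_mulr.
  by rewrite /coprimez /gcdz /= gcdnC (eqP cab).
case/dvdzP=> k xk; exists k; split; first by lia.
have nzb : b%:Z != 0 by lia.
(* After multiplying by [b], the product [k * b] can be traded for [x0 - x], and [eq_diff] makes the
   goal linear. *)
by apply: (mulfI nzb); rewrite mulrDr mulrCA (mulrC _ k) -xk eq_diff; lia.
Qed.

Theorem mainTheorem2 (a b : nat) (ha : (0 < a)%N) (hb : (0 < b)%N)
    (hab : gcdn a b = 1%N) (d : nat) (x0 y0 : int)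
    (hd : a%:Z * x0 + b%:Z * y0 = d%:Z) :
  C a b d <->
  exists k : int,
    if x0%:Q / b%:Q < - y0%:Q / a%:Q
    then k%:Q \in `[x0%:Q / b%:Q, - y0%:Q / a%:Q]
    else k%:Q \in `[- y0%:Q / a%:Q, x0%:Q / b%:Q].
Proof.
(* As [d] is nonnegative, the conditional reduces to its [else] branch. *)
rewrite ltNge (endpoints_le ha hb hd) /=; split.
- case=> x [y dxy].
  have [||k [xk yk]] := @coprime_solutions a b x%:Z y%:Z x0 y0 hb.
  + by rewrite /coprime hab.
  + by rewrite hd dxy PoszD !PoszM.
  by exists k; rewrite itv_solutionE // -xk -yk.
- case=> k; rewrite itv_solutionE // => /andP[y_ge0 x_ge0].
  (* Both integers are nonnegative, so [absz] keeps their values while landing in [nat]. *)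
  exists (absz (x0 - b%:Z * k)%R), (absz (y0 + a%:Z * k)%R).
  apply/eqP; rewrite -eqz_nat PoszD !PoszM !gez0_abs // -hd; apply/eqP.
  ring.
Qed.
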